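(* Let $K\ge1$, $N_1,\ldots,N_K\ge1$ integers, $T\ge1$, and let $\ell_t:\Delta_{N_1}\times\cdots\times\Delta_{N_K}\to\mathbb R$, $t\ge1$, be differentiable and jointly convex. Assume that for all $k$, $\max_{1\le t\le T}\sup_{\boldsymbol u}\max_{1\le i\le N_k}|\partial_{u^{(k)}_i}\ell_t(\boldsymbol u)|\le G^{(k)}$ with $G^{(k)}>0$. Then the Adaptive Multi-variable Exponentiated Gradient algorithm (described in the context) satisfies $$\sum_{t=1}^T\ell_t\big(\hat{\boldsymbol u}^{(1)}_t,\ldots,\hat{\boldsymbol u}^{(K)}_t\big)-\min_{(\boldsymbol u^{(1)},\ldots,\boldsymbol u^{(K)})}\sum_{t=1}^T\ell_t\big(\boldsymbol u^{(1)},\ldots,\boldsymbol u^{(K)}\big)\le2\sum_{k=1}^KG^{(k)}\sqrt{T^{(k)}\log N_k},$$ where $T^{(k)}=\sum_{t=1}^T\mathbb 1\{\sup_{\boldsymbol u}\max_i|\partial_{u^{(k)}_i}\ell_t(\boldsymbol u)|>0\}$ and the minimum is over $\Delta_{N_1}\times\cdots\times\Delta_{N_K}$.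
   Context: $\Delta_N=\{\boldsymbol u\in\mathbb R_+^N:\sum_iu_i=1\}$. Adaptive Multi-variable Exponentiated Gradient algorithm (with the constants $G^{(k)}$ as input): initialize $\hat{\boldsymbol u}^{(k)}_1=(1/N_k,\ldots,1/N_k)$. At each round $t$, output $(\hat{\boldsymbol u}^{(1)}_t,\ldots,\hat{\boldsymbol u}^{(K)}_t)$ and observe $\ell_t$; set $$\eta^{(k)}_{t+1}=\frac1{G^{(k)}}\sqrt{\frac{\log N_k}{1+\sum_{s=1}^t\mathbb 1\{\sup_{\boldsymbol u}\max_i|\partial_{u^{(k)}_i}\ell_s(\boldsymbol u)|>0\}}},$$ and $\hat u^{(k)}_{t+1,i}=\exp\big(-\eta^{(k)}_{t+1}\sum_{s=1}^t\partial_{u^{(k)}_i}\ell_s(\hat{\boldsymbol u}^{(1)}_s,\ldots,\hat{\boldsymbol u}^{(K)}_s)\big)/Z^{(k)}_{t+1}$, where $Z^{(k)}_{t+1}$ normalizes over $i\in\{1,\ldots,N_k\}$. *)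

(* Defs.v *)
From HB Require Import structures.
From mathcomp Require Import all_boot all_order all_algebra.
From mathcomp Require Import all_classical all_reals all_analysis.
Set Implicit Arguments. Unset Strict Implicit. Unset Printing Implicit Defensive.
Import Order.TTheory GRing.Theory Num.Theory.
Import numFieldNormedType.Exports.
Local Open Scope classical_set_scope.
Local Open Scope ring_scope.

(* A point (u^(1),...,u^(K)) of R^{N_1} x ... x R^{N_K} is stored as a flat
   row vector of size \sum_k N_k; coordinate i of block k is at index
   tagnat.Rank k i. *)
Section AMEG.
Variables (R : realType) (K : nat) (N : 'I_K -> nat).

Definition dimM : nat := (\sum_(k < K) N k)%N.
Definition idx (k : 'I_K) (i : 'I_(N k)) : 'I_dimM := @tagnat.Rank K N k i.
Definition coord (x : 'rV[R]_dimM) (k : 'I_K) (i : 'I_(N k)) : R := x ord0 (idx i).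

Definition in_prod (x : 'rV[R]_dimM) : Prop :=
  forall k : 'I_K, (forall i : 'I_(N k), 0 <= coord x i) /\
                   \sum_(i < N k) coord x i = 1.

Definition dpart (f : 'rV[R]_dimM -> R) (j : 'I_dimM) (x : 'rV[R]_dimM) : R :=
  'D_(delta_mx ord0 j) f x.
Definition partial (f : 'rV[R]_dimM -> R) (k : 'I_K) (i : 'I_(N k))
  (x : 'rV[R]_dimM) : R := dpart f (idx i) x.
Definition grad (f : 'rV[R]_dimM -> R) (x : 'rV[R]_dimM) : 'rV[R]_dimM :=
  \row_j dpart f j x.

Definition gsup (f : 'rV[R]_dimM -> R) (k : 'I_K) : R :=
  sup [set y | exists x (i : 'I_(N k)), in_prod x /\ y = `|partial f i x|].

Variables (G : 'I_K -> R) (l : nat -> 'rV[R]_dimM -> R).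

(* rounds are 0-indexed: l 0, l 1, ... are the paper's l_1, l_2, ... *)
Definition active_rounds (k : 'I_K) (t : nat) : nat :=
  (\sum_(s < t) nat_of_bool (0 < gsup (l s) k)%R)%N.

(* learning rate used for the iterate of (0-indexed) round t
   (= paper's eta^{(k)}_{t+1} with t observed rounds) *)
Definition eta (k : 'I_K) (t : nat) : R :=
  (G k)^-1 * Num.sqrt (ln (N k)%:R / (1 + (active_rounds k t)%:R)).

Definition iterate_of (C : 'rV[R]_dimM) (t : nat) : 'rV[R]_dimM :=
  \row_j (let k := tagnat.sig1 j in
          expR (- eta k t * C ord0 j) /
          \sum_(i < N k) expR (- eta k t * C ord0 (idx i))).

Fixpoint cumgrad (t : nat) : 'rV[R]_dimM :=
  match t with
  | 0 => 0
  | s.+1 => cumgrad s + grad (l s) (iterate_of (cumgrad s) s)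
  end.

Definition uhat (t : nat) : 'rV[R]_dimM := iterate_of (cumgrad t) t.

End AMEG.

(* Main.v *)
(** Convexity bounds the regret by the linearized regret, which splits into one
    exponential-weights regret per block.  For a block of size n with cumulative
    gradients C, the potential P(e, C) = ln (mean of exp (- e C_i)) / e is
    nondecreasing in e (power means), and by Hoeffding's lemma a round with rate
    e and gradients bounded by b costs at most the drop of P plus e b^2 / 2.
    Rounds with zero gradient change neither C nor the rate, so only active
    rounds count: the m-th one uses e_m = sqrt (ln n / m) / b, the costs
    e_m b^2 / 2 telescope since 1 / (2 sqrt m) <= sqrt m - sqrt (m - 1), and
    - P(e_m, C) <= <u, C> + ln n / e_m.  Both terms equal b sqrt (m ln n) at the
    last active round, whence the constant 2. *)

From HB Require Import structures.
From mathcomp Require Import all_boot all_order all_algebra.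
From mathcomp Require Import all_classical all_reals all_analysis.
From mathcomp Require Import ring lra.
Require Import Defs.
Import Order.TTheory GRing.Theory Num.Theory.
Import numFieldNormedType.Exports.
Local Open Scope ring_scope.

(** * Scalar inequalities and Hoeffding's lemma *)

Lemma ge0_is_derive_le (R : realType) (f df : R -> R) :
  (forall x : R, is_derive x 1 f (df x)) -> (forall x, 0 <= x -> 0 <= df x) ->
  forall a, 0 <= a -> f 0 <= f a.
Proof.
move=> fdf df0 a a0.
have f_derivable x : derivable f x 1 by have [] := fdf x.
apply: (@ger0_derive1_le_cc _ f 0 a) => //.
- move=> x; rewrite in_itv/= => /andP[x0 _].
  by rewrite derive1E (@derive_val _ _ _ _ _ _ _ (fdf x)) df0// ltW.
- apply: continuous_subspaceT => x; apply: differentiable_continuous.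
  exact/derivable1_diffP.
- by rewrite in_itv/= lexx a0.
- by rewrite in_itv/= lexx a0.
Qed.

(** The tangent of [expR] at [a * x] lies below its values at [a] and [- a]; weighted by
    [(1 + x) / 2] and [(1 - x) / 2], the slope terms cancel because these weights average [a] and
    [- a] to [a * x]. *)
Lemma expR_chord (R : realType) (a x : R) : -1 <= x <= 1 ->
  expR (a * x) <= (1 + x) / 2 * expR a + (1 - x) / 2 * expR (- a).
Proof.
move=> /andP[x1 x2].
have h z : expR (a * x) * (1 + (z - a * x)) <= expR z.
  rewrite -[in leRHS](subrKC (a * x) z) expRD.
  by rewrite ler_pM2l ?expR_gt0// expR_ge1Dx.
have h1 : (1 + x) / 2 * (expR (a * x) * (1 + (a - a * x))) <= (1 + x) / 2 * expR a.
  by apply: ler_wpM2l; [lra|exact: h].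
have h2 : (1 - x) / 2 * (expR (a * x) * (1 + (- a - a * x))) <= (1 - x) / 2 * expR (- a).
  by apply: ler_wpM2l; [lra|exact: h].
apply: le_trans (lerD h1 h2).
by rewrite le_eqVlt; apply/orP; left; apply/eqP; field.
Qed.

(** Hoeffding's bound for a variable with values 1 and -1 and mean [m]: [D] is its moment generating
    function, and the slope of [ln D] is bounded, then integrated. *)
Lemma two_point_mgf_le (R : realType) (m a : R) : -1 <= m <= 1 -> 0 <= a ->
  (1 + m) / 2 * expR a + (1 - m) / 2 * expR (- a) <= expR (m * a + a ^+ 2 / 2).
Proof.
move=> /andP[m1 m2] a0.
pose D x := (1 + m) / 2 * expR x + (1 - m) / 2 * expR (- x) : R.
pose E x := (1 + m) / 2 * expR x - (1 - m) / 2 * expR (- x) : R.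
have dD (x : R) : is_derive x 1 D (E x).
  by rewrite /D /E; apply: is_derive_eq; rewrite /GRing.scale /=; ring.
have dE (x : R) : is_derive x 1 E (D x).
  by rewrite /D /E; apply: is_derive_eq; rewrite /GRing.scale /=; ring.
have D_gt0 x : 0 < D x.
  rewrite /D; case: (ltP 0 m) => m0.
    rewrite ltr_pwDl ?mulr_ge0 ?mulr_gt0 ?expR_gt0 ?expR_ge0 ?divr_ge0//; lra.
  rewrite ltr_wpDl ?mulr_ge0 ?mulr_gt0 ?expR_gt0 ?expR_ge0 ?divr_ge0//; lra.
have D0 : D 0 = 1 by rewrite /D oppr0 expR0; field.
have E0 : E 0 = m by rewrite /E oppr0 expR0; field.
(* Since [D' = E] and [E' = D], the derivative of [E / D] is [1 - (E / D) ^+ 2], at most 1, and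
   [E / D] starts at [m]. *)
have slope x : 0 <= x -> E x <= (m + x) * D x.
  move=> x0.
  have dq (y : R) : is_derive y 1 (fun y => y - E y * (D y)^-1) ((E y / D y) ^+ 2).
    have Dy : D y != 0 by rewrite gt_eqF.
    have := is_deriveV Dy (dD y) => dV.
    apply: is_derive_eq; rewrite /GRing.scale /=; by field.
  have := @ge0_is_derive_le _ _ _ dq (fun y _ => sqr_ge0 _) _ x0.
  rewrite /= D0 E0 invr1 mulr1 sub0r => h.
  rewrite -ler_pdivrMr//; lra.
(* Integrating factor: by [slope], [D] divided by the claimed bound is nonincreasing, and it equals
   1 at 0. *)
have dF (y : R) : is_derive y 1 (fun y => - (expR (- (m * y + y ^+ 2 / 2)) * D y))
    (expR (- (m * y + y ^+ 2 / 2)) * ((m + y) * D y - E y)).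
  apply: is_derive_eq; rewrite /GRing.scale /=; by field.
have := @ge0_is_derive_le _ _ _ dF _ _ a0.
rewrite /= D0 mulr0 expr0n/= mul0r addr0 oppr0 expR0 mulr1 => h.
have {}h : expR (- (m * a + a ^+ 2 / 2)) * D a <= 1.
  rewrite -lerN2; apply: h => x x0.
  by rewrite mulr_ge0 ?expR_ge0// subr_ge0 slope.
by rewrite -/(D a); move: h; rewrite expRN mulrC ler_pdivrMr ?expR_gt0// mul1r.
Qed.

(** After rescaling to [-1, 1], the chord bound replaces each value by a two-point law with the same
    mean, so the mixture is a two-point law with mean [m]. *)
Lemma hoeffding_mgf_le (R : realType) n (p g : 'I_n -> R) (s b : R) :
  (forall i, 0 <= p i) -> \sum_i p i = 1 -> 0 < b -> 0 <= s ->
  (forall i, `|g i| <= b) ->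
  \sum_i p i * expR (- s * g i) <=
  expR (- s * (\sum_i p i * g i) + (s * b) ^+ 2 / 2).
Proof.
move=> p0 p1 b0 s0 gb.
have bn0 : b != 0 by rewrite gt_eqF.
pose x i := - (g i / b).
have x1 i : -1 <= x i <= 1.
  rewrite -ler_norml /x normrN normrM normfV (gtr0_norm b0).
  by rewrite ler_pdivrMr// mul1r.
pose m := \sum_i p i * x i.
have m1 : -1 <= m <= 1.
  apply/andP; split.
    rewrite -p1 -sumrN ler_sum// => i _.
    by have := x1 i; have := p0 i; nra.
  rewrite -p1 ler_sum// => i _.
  by have := x1 i; have := p0 i; nra.
have -> : - s * (\sum_i p i * g i) = m * (s * b).
  rewrite /m mulr_sumr mulr_suml; apply: eq_bigr => i _.
  by rewrite /x; field.
apply: le_trans (two_point_mgf_le _ _ _ m1 _); last by rewrite mulr_ge0// ltW.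
set e1 := expR (s * b); set e2 := expR (- (s * b)).
have -> : (1 + m) / 2 * e1 + (1 - m) / 2 * e2 =
   \sum_i p i * ((1 + x i) / 2 * e1 + (1 - x i) / 2 * e2).
  transitivity (\sum_i (p i * ((e1 + e2) / 2) + p i * x i * ((e1 - e2) / 2))).
    by rewrite big_split/= -!mulr_suml p1 -/m; field.
  by apply: eq_bigr => i _; field.
apply: ler_sum => i _; apply: ler_wpM2l => //.
apply: le_trans (expR_chord _ (s * b) _ (x1 i)).
by rewrite ler_expR le_eqVlt; apply/orP; left; apply/eqP; rewrite /x; field.
Qed.

Lemma sqrtr_half_step (R : realType) m :
  (2 * Num.sqrt m.+1%:R)^-1 + Num.sqrt m%:R <= Num.sqrt m.+1%:R :> R.
Proof.
set x := Num.sqrt m%:R; set y := Num.sqrt m.+1%:R.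
have x0 : 0 <= x by exact: sqrtr_ge0.
have y0 : 0 < y by rewrite sqrtr_gt0 ltr0n.
have xx : x ^+ 2 = m%:R by rewrite sqr_sqrtr// ler0n.
have yy : y ^+ 2 = m%:R + 1 by rewrite sqr_sqrtr ?ler0n// -natr1.
rewrite -lerBrDr -div1r ler_pdivrMr ?mulr_gt0//.
(* With [y ^+ 2 - x ^+ 2 = 1], the claim [1 <= (y - x) * (2 * y)] is exactly [0 <= (x - y) ^+ 2]. *)
by have := sqr_ge0 (x - y); nra.
Qed.

(** * Exponential weights on one simplex *)

Section ExponentialWeights.
Variables (R : realType) (n : nat).
Implicit Types (C u : 'I_n -> R) (e : R).

(** A mean instead of a sum makes the potential vanish at [C = 0] and grow with the rate. *)
Definition mean_exp e C : R := (\sum_i expR (- e * C i)) / n%:R.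
Definition potential e C : R := ln (mean_exp e C) / e.

Hypothesis n_gt0 : (0 < n)%N.

Let nR_gt0 : 0 < n%:R :> R. Proof. by rewrite ltr0n. Qed.

Lemma sum_expR_gt0 e C : 0 < \sum_i expR (- e * C i).
Proof.
rewrite (bigD1 (Ordinal n_gt0))//= ltr_pwDl ?expR_gt0//.
by rewrite sumr_ge0// => i _; rewrite expR_ge0.
Qed.

Lemma mean_exp_gt0 e C : 0 < mean_exp e C.
Proof. by rewrite divr_gt0 ?sum_expR_gt0. Qed.

Lemma potential0 e : potential e (fun=> 0) = 0.
Proof.
rewrite /potential /mean_exp; under eq_bigr do rewrite mulr0 expR0.
by rewrite sumr_const card_ord divff ?gt_eqF// ln1 mul0r.
Qed.

(* The power mean inequality. *)
Lemma potential_le C (e f : R) : 0 < e -> e <= f -> potential e C <= potential f C.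
Proof.
move=> e0 ef; have f0 := lt_le_trans e0 ef.
set A := mean_exp e C; have A0 : 0 < A by exact: mean_exp_gt0.
pose r := f / e.
have r1 : 1 <= r by rewrite /r ler_pdivlMr// mul1r.
have en0 : e != 0 by rewrite gt_eqF.
(* Bernoulli's inequality for the base [expR y] and exponent [r], from the tangent at [y] evaluated
   at [r * y] and at 0. *)
have bernoulli y : 1 + r * (expR y - 1) <= expR (r * y) :> R.
  have h z : expR y * (1 + (z - y)) <= expR z.
    rewrite -[in leRHS](subrKC y z) expRD.
    by rewrite ler_pM2l ?expR_gt0// expR_ge1Dx.
  have := h (r * y); have := h 0; rewrite expR0 => h0 hr.
  have : (r - 1) * (expR y * (1 + (0 - y))) <= (r - 1) * 1.
    by rewrite ler_wpM2l// subr_ge0.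
  by move: hr; lra.
(* Bernoulli is applied to the terms [expR (- e * C i) / A]; their mean is 1, so the first-order
   parts sum to zero. *)
have key : expR (r * ln A) <= mean_exp f C.
  rewrite /mean_exp ler_pdivlMr//.
  have -> : expR (r * ln A) * n%:R =
      \sum_i expR (r * ln A) * (1 + r * (expR (- e * C i) / A - 1)).
    rewrite -mulr_sumr; congr (_ * _).
    rewrite big_split/= sumr_const card_ord -mulr_sumr sumrB sumr_const card_ord.
    rewrite -mulr_suml; have -> : \sum_i expR (- e * C i) = A * n%:R.
      by rewrite /A /mean_exp mulfVK// gt_eqF.
    by field; rewrite gt_eqF.
  apply: ler_sum => i _.
  have -> : expR (- f * C i) = expR (r * ln A) * expR (r * (- e * C i - ln A)).
    by rewrite -expRD; congr expR; rewrite /r; field.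
  rewrite ler_pM2l ?expR_gt0//.
  have <- : expR (- e * C i - ln A) = expR (- e * C i) / A.
    by rewrite expRD expRN lnK.
  exact: bernoulli.
rewrite /potential -/A ler_pdivlMr//.
have -> : ln A / e * f = r * ln A by rewrite /r; field.
by rewrite -[leLHS]expRK ler_ln ?posrE ?expR_gt0 ?mean_exp_gt0.
Qed.

(** Jensen for [expR] under the weights [u], via the tangent at [- e * c]; the weights are then
    bounded by 1, and the normalization by [n] produces [ln n%:R / e]. *)
Lemma potential_ge C u e : 0 < e -> (forall i, 0 <= u i) -> \sum_i u i = 1 ->
  - potential e C <= \sum_i u i * C i + ln n%:R / e.
Proof.
move=> e0 u0 u1; set c := \sum_i u i * C i.
have u_le1 i : u i <= 1.
  by rewrite -u1 (bigD1 i)//= lerDl sumr_ge0.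
have h : expR (- e * c) <= \sum_i expR (- e * C i).
  have -> : expR (- e * c) =
     \sum_i u i * (expR (- e * c) * (1 + (- e * C i - - e * c))).
    transitivity (\sum_i (u i * (expR (- e * c) * (1 + e * c))
                   - u i * C i * (expR (- e * c) * e))).
      by rewrite sumrB -!mulr_suml u1 -/c; ring.
    by apply: eq_bigr => i _; ring.
  apply: ler_sum => i _.
  have h : expR (- e * c) * (1 + (- e * C i - - e * c)) <= expR (- e * C i).
    rewrite -[in leRHS](subrKC (- e * c) (- e * C i)) expRD.
    by rewrite ler_pM2l ?expR_gt0// expR_ge1Dx.
  apply: le_trans (ler_wpM2l (u0 i) h) _.
  by rewrite ler_piMl ?expR_ge0.
have {}h : - e * c <= ln (\sum_i expR (- e * C i)).
  by rewrite -[leLHS]expRK ler_ln ?posrE ?expR_gt0 ?sum_expR_gt0.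
rewrite /potential /mean_exp ln_div ?posrE ?sum_expR_gt0//.
by rewrite -mulNr ler_pdivrMr// mulrDl divfK ?gt_eqF//; lra.
Qed.

Definition exp_weight e C i : R := expR (- e * C i) / \sum_j expR (- e * C j).

Lemma exp_weight_ge0 e C i : 0 <= exp_weight e C i.
Proof. by rewrite divr_ge0 ?expR_ge0 ?ltW ?sum_expR_gt0. Qed.

Lemma sum_exp_weight e C : \sum_i exp_weight e C i = 1.
Proof. by rewrite -mulr_suml divff// gt_eqF// sum_expR_gt0. Qed.

(** The average of [expR (- e * g i)] under the weights is the ratio of the new to the old
    [mean_exp], so the logarithm of Hoeffding's bound is a potential drop. *)
Lemma exp_weight_step C (g : 'I_n -> R) (e b : R) : 0 < e -> 0 < b ->
  (forall i, `|g i| <= b) ->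
  \sum_i exp_weight e C i * g i + potential e (fun i => C i + g i)
  <= potential e C + e * b ^+ 2 / 2.
Proof.
move=> e0 b0 gb.
have := hoeffding_mgf_le _ _ _ _ e b (exp_weight_ge0 e C) (sum_exp_weight e C)
  b0 (ltW e0) gb.
set m := \sum_i exp_weight e C i * g i.
have -> : \sum_i exp_weight e C i * expR (- e * g i) =
   mean_exp e (fun i => C i + g i) / mean_exp e C.
  transitivity ((\sum_i expR (- e * (C i + g i))) / \sum_i expR (- e * C i)).
    rewrite mulr_suml; apply: eq_bigr => i _.
    by rewrite /exp_weight mulrAC -expRD mulrDr.
  rewrite /mean_exp; field.
  by rewrite !gt_eqF ?sum_expR_gt0.
move=> h; rewrite -ler_ln ?posrE ?expR_gt0 ?divr_gt0 ?sum_expR_gt0// in h.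
rewrite expRK ln_div ?posrE ?mean_exp_gt0// in h.
rewrite /potential -(@ler_pM2r _ e)// !mulrDl !divfK ?gt_eqF//.
have -> : e * b ^+ 2 / 2 * e = (e * b) ^+ 2 / 2 by field.
by lra.
Qed.

(** * Regret of one block under the adaptive rate *)

Section Regret.
Variables (b : R) (T : nat) (g : nat -> 'I_n -> R) (active : nat -> bool).

Let cum t i : R := \sum_(s < t) g s i.
Let cnt t : nat := (\sum_(s < t) active s)%N.
(** Round [t] plays with [rate (cnt t).+1], whereas [rate (cnt t)] is the rate of the last active
    round before [t]; [rate 0] is 0 by the convention on division. *)
Let rate m : R := b^-1 * Num.sqrt (ln n%:R / m%:R).

Hypotheses (b_gt0 : 0 < b)
  (g_le : forall t i, (t < T)%N -> `|g t i| <= b)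
  (g_inactive : forall t i, (t < T)%N -> ~~ active t -> g t i = 0).

Let cumS t : cum t.+1 = (fun i => cum t i + g t i).
Proof. by apply/funext => i; rewrite /cum big_ord_recr. Qed.

Let cntS t : cnt t.+1 = (cnt t + active t)%N.
Proof. by rewrite /cnt big_ord_recr. Qed.

Let cum_inactive t : (t <= T)%N -> cnt t = 0%N -> cum t = (fun=> 0).
Proof.
elim: t => [_ _|t IH tT]; first by apply/funext => i; rewrite /cum big_ord0.
rewrite cntS; case: (boolP (active t)) => [_|ta]; rewrite ?addn1// addn0 => c0.
by rewrite cumS IH 1?ltnW//; apply/funext => i; rewrite g_inactive// addr0.
Qed.

Lemma rate_gt0 m : (1 < n)%N -> (0 < m)%N -> 0 < rate m.
Proof.
move=> n1 m0; rewrite mulr_gt0 ?invr_gt0// sqrtr_gt0 divr_gt0 ?ltr0n//.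
by rewrite ln_gt0// ltr1n.
Qed.

Lemma exp_weights_potential t : (1 < n)%N -> (t <= T)%N -> (0 < cnt t)%N ->
  \sum_(s < t) \sum_i exp_weight (rate (cnt s).+1) (cum s) i * g s i
  <= - potential (rate (cnt t)) (cum t)
     + b * Num.sqrt (ln n%:R) * Num.sqrt (cnt t)%:R.
Proof.
move=> n1; pose p s := exp_weight (rate (cnt s).+1) (cum s).
set L := Num.sqrt (ln n%:R).
have L0 : 0 <= L by exact: sqrtr_ge0.
have bn0 : b != 0 by rewrite gt_eqF.
elim: t => [|t IH] tT; first by rewrite /cnt big_ord0.
rewrite cntS big_ord_recr/=.
case: (boolP (active t)) => ta; last first.
  rewrite addn0 => ct; rewrite [X in _ + X]big1 ?addr0; last first.
    by move=> i _; rewrite g_inactive// mulr0.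
  have -> : cum t.+1 = cum t.
    by rewrite cumS; apply/funext => i; rewrite g_inactive// addr0.
  exact: IH (ltnW tT) ct.
rewrite addn1 => _.
set r := rate (cnt t).+1.
have r0 : 0 < r by exact: rate_gt0.
(* Passing to the smaller rate [r] only helps, by monotonicity of the potential. Before the first
   active round all gradients vanish and so does the left side. *)
have prev : \sum_(s < t) \sum_i p s i * g s i <=
    - potential r (cum t) + b * L * Num.sqrt (cnt t)%:R.
  have [c0|c0] := posnP (cnt t).
    rewrite cum_inactive// 1?ltnW// potential0 oppr0 add0r c0 sqrtr0 mulr0.
    rewrite big1// => s _; rewrite big1// => i _.
    have st := ltn_ord s.
    rewrite g_inactive ?mulr0//; first exact: ltn_trans tT.
    apply/negP => sa; move: c0; rewrite /cnt (bigD1 s)//= sa.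
    by rewrite add1n.
  apply: le_trans (IH (ltnW tT) c0) _.
  rewrite lerD2r lerN2; apply: potential_le => //.
  apply: ler_wpM2l; first by rewrite invr_ge0 ltW.
  apply: ler_wsqrtr; rewrite ler_wpM2l ?ln_ge0 ?ler1n// lef_pV2 ?posrE ?ltr0n// ler_nat.
  exact: leqnSn.
have step := exp_weight_step (cum t) (g t) r b r0 b_gt0 (fun i => g_le t i tT).
rewrite -cumS -/(p t) in step.
have rE : r * b ^+ 2 / 2 = b * L * (2 * Num.sqrt (cnt t).+1%:R)^-1.
  rewrite /r /rate sqrtrM ?ln_ge0 ?ler1n// sqrtrV ?ler0n// -/L.
  by field; rewrite bn0/= gt_eqF// sqrtr_gt0 ltr0n.
have half := ler_wpM2l (mulr_ge0 (ltW b_gt0) L0) (sqrtr_half_step R (cnt t)).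
rewrite mulrDr in half.
by rewrite rE in step; lra.
Qed.

Lemma exp_weights_regret u : (forall i, 0 <= u i) -> \sum_i u i = 1 ->
  \sum_(t < T) \sum_i (exp_weight (rate (cnt t).+1) (cum t) i - u i) * g t i
  <= 2 * (b * Num.sqrt ((cnt T)%:R * ln n%:R)).
Proof.
move=> u0 u1.
have [n1|n1] := ltnP 1 n; last first.
  (* Here [n = 1]: the rates vanish with [ln 1], but the simplex is a single point and the regret is
     zero. *)
  have w1 (w : 'I_n -> R) i : \sum_i w i = 1 -> w i = 1.
    move=> <-; rewrite (bigD1 i)//= big1 ?addr0// => j /negP[]; apply/eqP.
    have lt1 (k : 'I_n) : val k = 0%N.
      by apply/eqP; rewrite -leqn0 -ltnS (leq_trans (ltn_ord k)).
    by apply: val_inj; rewrite !lt1.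
  rewrite big1 => [|t _]; last first.
    rewrite big1// => i _; rewrite (w1 u i u1) (w1 _ i (sum_exp_weight _ _)).
    by rewrite subrr mul0r.
  by rewrite !mulr_ge0 ?sqrtr_ge0// ltW.
have [c0|c0] := posnP (cnt T).
  rewrite big1 => [|t _]; first by rewrite !mulr_ge0 ?sqrtr_ge0// ltW.
  rewrite big1// => i _; rewrite g_inactive ?mulr0//.
  apply/negP => ta; move: c0; rewrite /cnt (bigD1 t)//= ta.
  by rewrite add1n.
have r0 := rate_gt0 (cnt T) n1 c0.
have hp := exp_weights_potential T n1 (leqnn T) c0.
have hu := potential_ge (cum T) u _ r0 u0 u1.
have -> : \sum_(t < T) \sum_i (exp_weight (rate (cnt t).+1) (cum t) i - u i) * g t i
  = \sum_(t < T) \sum_i exp_weight (rate (cnt t).+1) (cum t) i * g t i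
    - \sum_i u i * cum T i.
  have -> : \sum_i u i * cum T i = \sum_(t < T) \sum_i u i * g t i.
    by rewrite exchange_big/=; apply: eq_bigr => i _; rewrite mulr_sumr.
  rewrite -sumrB; apply: eq_bigr => t _; rewrite -sumrB.
  by apply: eq_bigr => i _; rewrite mulrBl.
have lnn0 : 0 < ln n%:R :> R by rewrite ln_gt0// ltr1n.
rewrite sqrtrM ?ler0n//.
set L := Num.sqrt (ln n%:R) in hp *; set S := Num.sqrt _ in hp *.
have L0 : L != 0 by rewrite gt_eqF// sqrtr_gt0.
have S0 : S != 0 by rewrite gt_eqF// sqrtr_gt0 ltr0n.
have LE : ln n%:R = L ^+ 2 :> R by rewrite sqr_sqrtr// ltW.
(* The comparator term equals the accumulated cost bound, which gives the factor 2. *)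
have rE : ln n%:R / rate (cnt T) = b * L * S.
  rewrite /rate sqrtrM ?ltW// sqrtrV ?ler0n// -/L -/S LE.
  by field; rewrite L0 S0 gt_eqF.
by rewrite rE in hu; lra.
Qed.

End Regret.
End ExponentialWeights.

(** * Linearization by convexity and reduction to blocks *)

Lemma sum_idx (R : realType) (K : nat) (N : 'I_K -> nat) (F : 'I_(dimM N) -> R) :
  \sum_j F j = \sum_k \sum_(i < N k) F (idx i).
Proof.
rewrite sig_big_dep/= (reindex (@tagnat.rank K N)); last first.
  exact/onW_bij/tagnat.rank_bij.
by apply: eq_bigr => p _; rewrite tagnat.rankE.
Qed.

Lemma derive_row (R : realType) (n : nat) (f : 'rV[R]_n -> R) (x v : 'rV[R]_n) :
  differentiable f x ->
  'D_v f x = \sum_j v ord0 j * 'D_(delta_mx ord0 j) f x.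
Proof.
move=> df; rewrite deriveE// {1}(row_sum_delta v) linear_sum/=.
by apply: eq_bigr => j _; rewrite linearZ/= deriveE.
Qed.

Lemma convex_derive_le (R : realType) (V : normedModType R) (f : V -> R) (x y : V) :
  derivable f x (y - x) ->
  (forall a : R, 0 <= a <= 1 ->
     f (a *: y + (1 - a) *: x) <= a * f y + (1 - a) * f x) ->
  'D_(y - x) f x <= f y - f x.
Proof.
move=> df cf.
(* Convexity controls the difference quotient only for steps in [0, 1], so the limit is taken from
   the right. *)
rewrite /derive cvg_at_rightE//; apply: limr_le.
  apply/cvg_ex; exists ('D_(y - x) f x).
  apply: cvg_trans df; apply: cvg_app.
  move=> A [e e0 Ae]; exists e => // h he h0; apply: Ae => //.
  exact/lt0r_neq0.
near=> h.
have h0 : 0 < h by near: h; exact: nbhs_right_gt.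
have h1 : h <= 1 by near: h; exact: nbhs_right_le.
rewrite /GRing.scale/= mulrC ler_pdivrMr//.
have -> : h *: (y - x) + x = h *: y + (1 - h) *: x.
  by rewrite scalerBr scalerBl scale1r addrAC addrA.
have := cf h; rewrite (ltW h0) h1 => /(_ isT); lra.
Unshelve. all: by end_near.
Qed.

Lemma coord_iterate_of (R : realType) (K : nat) (N : 'I_K -> nat) (G : 'I_K -> R)
    (l : nat -> 'rV[R]_(dimM N) -> R) (C : 'rV[R]_(dimM N)) t k (i : 'I_(N k)) :
  coord (iterate_of G l C t) i =
  expR (- eta G l k t * coord C i) /
    \sum_(j < N k) expR (- eta G l k t * coord C j).
Proof. by rewrite /coord mxE /= tagnat.Rank1K. Qed.

Lemma partial_inactive (R : realType) (K : nat) (N : 'I_K -> nat)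
    (f : 'rV[R]_(dimM N) -> R) k (b : R) :
  (forall x, in_prod x -> forall i : 'I_(N k), `|partial f i x| <= b) ->
  ~~ (0 < gsup f k) -> forall x (i : 'I_(N k)), in_prod x -> partial f i x = 0.
Proof.
move=> fb; rewrite -leNgt => f0 x i xP; apply/eqP; rewrite -normr_le0.
apply: le_trans f0; apply: sup_upper_bound; last by exists x, i.
(* [sup] is known to be an upper bound only for a nonempty set that is bounded above; [b] supplies
   the bound. *)
split; first by exists `|partial f i x|, x, i.
by exists b => _ [z [j [zP ->]]]; exact: fb.
Qed.

Lemma coord_cumgrad (R : realType) (K : nat) (N : 'I_K -> nat) (G : 'I_K -> R)
    (l : nat -> 'rV[R]_(dimM N) -> R) t k (i : 'I_(N k)) :
  coord (cumgrad G l t) i = \sum_(s < t) partial (l s) i (uhat G l s).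
Proof.
elim: t => [|t IH]; first by rewrite /coord mxE big_ord0.
by rewrite big_ord_recr/= -IH /coord mxE [in X in _ + X = _]mxE.
Qed.

Lemma coord_uhat (R : realType) (K : nat) (N : 'I_K -> nat) (G : 'I_K -> R)
    (l : nat -> 'rV[R]_(dimM N) -> R) t k (i : 'I_(N k)) :
  coord (uhat G l t) i =
  exp_weight R (N k) (eta G l k t)
    (fun j => \sum_(s < t) partial (l s) j (uhat G l s)) i.
Proof.
rewrite coord_iterate_of /exp_weight coord_cumgrad.
by congr (_ / _); apply: eq_bigr => j _; rewrite coord_cumgrad.
Qed.

Lemma in_prod_uhat (R : realType) (K : nat) (N : 'I_K -> nat) (G : 'I_K -> R)
    (l : nat -> 'rV[R]_(dimM N) -> R) t :
  (forall k, (0 < N k)%N) -> in_prod (uhat G l t).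
Proof.
move=> N0 k; split => [i|]; first by rewrite coord_uhat exp_weight_ge0.
by under eq_bigr do rewrite coord_uhat; rewrite sum_exp_weight.
Qed.

Theorem theorem9 (R : realType) (K : nat) (N : 'I_K -> nat) (T : nat)
  (G : 'I_K -> R) (l : nat -> 'rV[R]_(dimM N) -> R) :
  (0 < K)%N -> (forall k, (0 < N k)%N) -> (0 < T)%N ->
  (forall t x, in_prod x -> differentiable (l t) x) ->
  (forall t x y (a : R), in_prod x -> in_prod y -> 0 <= a <= 1 ->
     l t (a *: x + (1 - a) *: y) <= a * l t x + (1 - a) * l t y) ->
  (forall k, 0 < G k) ->
  (forall k t, (t < T)%N -> forall x, in_prod x ->
     forall i : 'I_(N k), `|partial (l t) i x| <= G k) ->
  forall u, in_prod u ->
    \sum_(t < T) l t (uhat G l t) - \sum_(t < T) l t u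
    <= 2 * \sum_(k < K) G k * Num.sqrt ((active_rounds l k T)%:R * ln (N k)%:R).
Proof.
move=> _ N0 _ dl cl G0 lG u uP.
pose g k t (i : 'I_(N k)) := partial (l t) i (uhat G l t).
have xP t : in_prod (uhat G l t) by exact: in_prod_uhat.
have linearized t : l t (uhat G l t) - l t u <=
    \sum_k \sum_i (coord (uhat G l t) i - coord u i) * g k t i.
  have := convex_derive_le _ _ (l t) (uhat G l t) u
    (diff_derivable (dl t _ (xP t))) (fun a => cl t _ _ a uP (xP t)).
  rewrite derive_row; last exact: dl.
  rewrite sum_idx => h; rewrite -lerN2 opprB; apply: le_trans h.
  rewrite -sumrN; apply: ler_sum => k _; rewrite -sumrN; apply: ler_sum => i _.
  rewrite /g /partial /dpart /coord; move: (uhat G l t) => x.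
  by rewrite !mxE; lra.
rewrite -sumrB mulr_sumr.
apply: (@le_trans _ _ (\sum_(t < T) \sum_k \sum_i
    (coord (uhat G l t) i - coord u i) * g k t i)).
  by apply: ler_sum => t _; exact: linearized.
rewrite exchange_big/=; apply: ler_sum => k _.
have [u0 u1] := uP k.
(* Block [k] is an instance with bound [G k], where a round is active when its [gsup] is
   positive. *)
have := exp_weights_regret R (N k) (N0 k) (G k) T (g k)
  (fun t => 0 < gsup (l t) k) (G0 k).
move=> /(_ (fun t i tT => lG k t tT _ (xP t) i)).
move=> /(_ (fun t i tT ta => partial_inactive _ _ _ _ _ _ (lG k t tT) ta _ _ (xP t))).
move=> /(_ _ u0 u1); apply: le_trans.
rewrite le_eqVlt; apply/orP; left; apply/eqP.
apply: eq_bigr => t _; apply: eq_bigr => i _.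
(* The [1 +] in the denominator of [eta] is the successor in [rate (cnt t).+1]. *)
by rewrite coord_uhat /eta -[1]/(1%:R) -natrD add1n.
Qed.
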